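(* For every formula $\varphi$: if $\varphi$ is provable in $\mathbf{H}\mathsf{K}$, then $\varphi$ is valid in the non-standard semantics.
   Context: Syntax: types $\mathsf{TYPE}=\{\mathsf{agt},\mathsf{obj},\mathsf{agtobj}\}$ ordered by the reflexive order $\preccurlyeq$ with $\mathsf{agt}\preccurlyeq\mathsf{agtobj}$, $\mathsf{obj}\preccurlyeq\mathsf{agtobj}$. A signature $\langle \mathrm{VAR},\mathrm{CON},\mathrm{FUN},\mathrm{REL},\mathrm{type}\rangle$: countably infinite $\mathrm{VAR}$ (infinitely many variables of type $\mathsf{agt}$ and of type $\mathsf{obj}$; every variable has one of these types), countable $\mathrm{CON}$ (types in $\{\mathsf{agt},\mathsf{obj}\}$), countable $\mathrm{FUN}$ (each $f$ typed $\langle\tau_1,\dots,\tau_n,\tau_{n+1}\rangle$, $\tau_i\in\mathsf{TYPE}$, $\tau_{n+1}\in\{\mathsf{agt},\mathsf{obj}\}$), countable $\mathrm{REL}\ni{=}$ with $\mathrm{type}(=)=\langle\mathsf{agtobj},\mathsf{agtobj}\rangle$ and other $P$ typed in $\mathsf{TYPE}^n$. Terms: variables and constants of their types; $f(t_1,\dots,t_n)$ of type $\tau'_{n+1}$ when $\mathrm{type}(t_i)\preccurlyeq\tau'_i$. Formulas: $P(t_1,\dots,t_n)$ (with $\mathrm{type}(t_i)\preccurlyeq$ the $i$-th argument type of $P$; $P$ may be $=$), $\neg\varphi$, $\varphi\wedge\psi$, $K_s\varphi$ with $\mathrm{type}(s)=\mathsf{agt}$, $\forall x\varphi$; $\to,\exists,\neq$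 are the usual abbreviations. Free variables of $K_t\varphi$ are those of $t$ plus those free in $\varphi$. Substitution $\varphi(s/x)$ is the usual one with $(K_t\varphi)(s/x)=K_{t(s/x)}\varphi(s/x)$, used only when $\mathrm{type}(x)=\mathrm{type}(s)$ and no variable of $s$ is bound in $\varphi$. Non-standard semantics: a frame $\langle D,W,R\rangle$ has $D=D_{\mathsf{agtobj}}=D_{\mathsf{agt}}\sqcup D_{\mathsf{obj}}$ (both nonempty, disjoint), nonempty $W$, and $R_i\subseteq W\times W$ for each $i\in D_{\mathsf{agt}}$. A non-standard model $N=\langle D,W,R,J\rangle$ has: $J(c,w,X)\in D_{\mathrm{type}(c)}$ for every constant $c$, world $w$ and every $X\subseteq D^n$ (any $n\in\mathbb{N}$); $J(f,w,X):D_{\tau_1}\times\cdots\times D_{\tau_n}\to D_{\tau_{n+1}}$ for each such $X$, where $\mathrm{type}(f)=\langle\tau_1,\dots,\tau_{n+1}\rangle$; $J(=,w)=\{\langle d,d\rangle:d\in D\}$; $J(P,w)\subseteq D_{\tau_1}\times\cdots\times D_{\tau_n}$ for other $P$. Valuations $v:\mathrm{VAR}\to D$ with $v(x)\in D_{\mathrm{type}(x)}$; $v[x\mapsto d]$ is the $x$-variant. Term extension relative to $X$: $[\![x]\!]^{J,v}_{w,X}=v(x)$, $[\![c]\!]^{J,v}_{w,X}=J(c,w,X)$, $[\![f(t_1,\dots,t_n)]\!]^{J,v}_{w,X}=J(f,w,X)([\![t_1]\!]^{J,v}_{w,X},\dots,[\![t_n]\!]^{J,v}_{w,X})$. Satisfaction: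 $N,w\models_vP(t_1,\dots,t_n)$ iff $\langle[\![t_1]\!]^{J,v}_{w,J(P,w)},\dots,[\![t_n]\!]^{J,v}_{w,J(P,w)}\rangle\in J(P,w)$ ($P$ may be $=$); classical clauses for $\neg,\wedge$; $N,w\models_v\forall x\varphi$ iff $N,w\models_{v[x\mapsto d]}\varphi$ for all $d\in D_{\mathrm{type}(x)}$; $N,w\models_vK_t\varphi$ iff $N,w'\models_v\varphi$ for all $w'$ with $\langle w,w'\rangle\in R_{[\![t]\!]^{J,v}_{w,\emptyset}}$. A formula is valid in the non-standard semantics if it is satisfied at every world of every non-standard model under every valuation. The system $\mathbf{H}\mathsf{K}$: axioms are all propositional tautologies; $\forall x\varphi\to\varphi(y/x)$ ($y$ a variable); $t=t$; $x=y\to(\varphi(x/z)\to\varphi(y/z))$ ($x,y$ variables); $c=c\to\exists x(x=c)$; $x\neq y$ whenever $\mathrm{type}(x)\neq\mathrm{type}(y)$; $K_t(\varphi\to\psi)\to(K_t\varphi\to K_t\psi)$; $\forall xK_t\varphi\to K_t\forall x\varphi$ for $x$ not occurring in $t$; $x\neq y\to K_t\,x\neq y$. Rules: from $\varphi$ and $\varphi\to\psi$ infer $\psi$; from $\varphi$ infer $K_t\varphi$; from $\varphi\to\psi$ infer $\varphi\to\forall x\psi$ for $x$ not free in $\varphi$.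
   Formalization: The axiom c=c → ∃x(x=c) is taken only for x with type(x)=type(c); when the types differ the formula is well formed but false in every model, since the agent and object domains are disjoint, so soundness would fail. *)

(* Defs.v *)
From mathcomp Require Import all_boot.
From mathcomp Require Import classical_sets.

Set Implicit Arguments.
Unset Strict Implicit.
Unset Printing Implicit Defensive.

Local Open Scope classical_set_scope.

(** * Signatures *)

Inductive ty := agt | obj | agtobj.

Definition tle (s t : ty) : bool :=
  match s, t with
  | agt, agt | obj, obj | _, agtobj => true
  | _, _ => false
  end.

Definition base_ty (t : ty) : Prop := t = agt \/ t = obj.

(* The type <tau_1, ..., tau_n, tau_{n+1}> of a function symbol f is split into
   [fargs f] = <tau_1, ..., tau_n> and [fres f] = tau_{n+1}. *)
Record signature := Signature {
  VAR : countType;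
  CON : countType;
  FUN : countType;
  REL : countType;
  eqs : REL;
  vtype : VAR -> ty;
  ctype : CON -> ty;
  fargs : FUN -> seq ty;
  fres : FUN -> ty;
  rtype : REL -> seq ty;
  vtype_base : forall x, base_ty (vtype x);
  vtype_inf : forall t, base_ty t ->
    forall s : seq VAR, exists x, x \notin s /\ vtype x = t;
  ctype_base : forall c, base_ty (ctype c);
  fres_base : forall f, base_ty (fres f);
  rtype_eqs : rtype eqs = [:: agtobj; agtobj]
}.

Arguments eqs {_}.
Arguments vtype {_}.
Arguments ctype {_}.
Arguments fargs {_}.
Arguments fres {_}.
Arguments rtype {_}.

(** * Terms and formulas *)

(* [tm] and [form] are raw expressions; the terms and the formulas of the
   language are those satisfying [wf_tm] and [wf]. *)
Inductive tm (S : signature) : Type :=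
| Var of VAR S
| Con of CON S
| Fun of FUN S & seq (tm S).

Inductive form (S : signature) : Type :=
| Atom of REL S & seq (tm S)
| Neg of form S
| And of form S & form S
| Know of tm S & form S
| All of VAR S & form S.

Arguments Var {S}.
Arguments Con {S}.
Arguments Fun {S}.
Arguments Atom {S}.
Arguments Neg {S}.
Arguments And {S}.
Arguments Know {S}.
Arguments All {S}.

Section Syntax.
Variable S : signature.
Implicit Types (x y z : VAR S) (s t : tm S) (phi psi : form S).

Definition ttype t : ty :=
  match t with
  | Var x => vtype x
  | Con c => ctype c
  | Fun f _ => fres f
  end.

Definition args_ok (ts : seq (tm S)) (taus : seq ty) : bool :=
  all2 (fun t tau => tle (ttype t) tau) ts taus.

Fixpoint wf_tm t : bool :=
  match t with
  | Var _ | Con _ => true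
  | Fun f ts => all wf_tm ts && args_ok ts (fargs f)
  end.

Fixpoint wf phi : Prop :=
  match phi with
  | Atom P ts => all wf_tm ts /\ args_ok ts (rtype P)
  | Neg phi => wf phi
  | And phi psi => wf phi /\ wf psi
  | Know t phi => [/\ wf_tm t, ttype t = agt & wf phi]
  | All _ phi => wf phi
  end.

Definition Imp phi psi := Neg (And phi (Neg psi)).
Definition Ex x phi := Neg (All x (Neg phi)).
Definition Eq s t := Atom eqs [:: s; t].
Definition Neq s t := Neg (Eq s t).

Fixpoint tvars t : seq (VAR S) :=
  match t with
  | Var x => [:: x]
  | Con _ => [::]
  | Fun _ ts => flatten (map tvars ts)
  end.

Fixpoint fvars phi : seq (VAR S) :=
  match phi with
  | Atom _ ts => flatten (map tvars ts)
  | Neg phi => fvars phi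
  | And phi psi => fvars phi ++ fvars psi
  | Know t phi => tvars t ++ fvars phi
  | All x phi => [seq y <- fvars phi | y != x]
  end.

Fixpoint bvars phi : seq (VAR S) :=
  match phi with
  | Atom _ _ => [::]
  | Neg phi => bvars phi
  | And phi psi => bvars phi ++ bvars psi
  | Know _ phi => bvars phi
  | All x phi => x :: bvars phi
  end.

Fixpoint tsubst s x t : tm S :=
  match t with
  | Var y => if y == x then s else Var y
  | Con c => Con c
  | Fun f ts => Fun f (map (tsubst s x) ts)
  end.

(* [subst s x phi] is phi(s/x). *)
Fixpoint subst s x phi : form S :=
  match phi with
  | Atom P ts => Atom P (map (tsubst s x) ts)
  | Neg phi => Neg (subst s x phi)
  | And phi psi => And (subst s x phi) (subst s x psi)
  | Know t phi => Know (tsubst s x t) (subst s x phi)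
  | All y phi => if y == x then All y phi else All y (subst s x phi)
  end.

Definition substitutable s x phi : Prop :=
  vtype x = ttype s /\ {in tvars s, forall y, y \notin bvars phi}.

(** * The Hilbert system HK *)

(* Formulas that are not negations or conjunctions (atoms, K_t phi and
   forall x phi) play the role of propositional letters. *)
Fixpoint peval (e : form S -> bool) phi : bool :=
  match phi with
  | Neg phi => ~~ peval e phi
  | And phi psi => peval e phi && peval e psi
  | _ => e phi
  end.

Definition tautology phi : Prop := forall e, peval e phi.

(* The well-formedness premises only say that the axioms and the conclusions
   of the rules are formulas of the language. In [HK_exid] the premise on types
   is needed: c = c -> exists x (x = c) is well-formed, but false in every
   model, when x and c have different types. *)
Inductive HK : form S -> Prop :=
| HK_taut phi :
    wf phi -> tautology phi -> HK phi
| HK_inst x y phi :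
    wf phi -> substitutable (Var y) x phi ->
    HK (Imp (All x phi) (subst (Var y) x phi))
| HK_refl t :
    wf_tm t -> HK (Eq t t)
| HK_leibniz x y z phi :
    wf phi -> substitutable (Var x) z phi -> substitutable (Var y) z phi ->
    HK (Imp (Eq (Var x) (Var y))
            (Imp (subst (Var x) z phi) (subst (Var y) z phi)))
| HK_exid c x :
    vtype x = ctype c ->
    HK (Imp (Eq (Con c) (Con c)) (Ex x (Eq (Var x) (Con c))))
| HK_neq_type x y :
    vtype x <> vtype y -> HK (Neq (Var x) (Var y))
| HK_K t phi psi :
    wf_tm t -> ttype t = agt -> wf phi -> wf psi ->
    HK (Imp (Know t (Imp phi psi)) (Imp (Know t phi) (Know t psi)))
| HK_barcan x t phi :
    wf_tm t -> ttype t = agt -> wf phi -> x \notin tvars t ->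
    HK (Imp (All x (Know t phi)) (Know t (All x phi)))
| HK_know_neq x y t :
    wf_tm t -> ttype t = agt ->
    HK (Imp (Neq (Var x) (Var y)) (Know t (Neq (Var x) (Var y))))
| HK_mp phi psi :
    HK phi -> HK (Imp phi psi) -> HK psi
| HK_nec t phi :
    wf_tm t -> ttype t = agt -> HK phi -> HK (Know t phi)
| HK_gen x phi psi :
    x \notin fvars phi -> HK (Imp phi psi) -> HK (Imp phi (All x psi)).

End Syntax.

(** * Non-standard semantics *)

(* Only the relations [R i] with [i] an agent matter: well-formed formulas
   consult no other. *)
Record frame := Frame {
  D : Type;
  Dagt : set D;
  Dobj : set D;
  W : Type;
  R : D -> W -> W -> Prop;
  Dagt_neq0 : Dagt !=set0;
  Dobj_neq0 : Dobj !=set0;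
  Dagt_obj_disj : Dagt `&` Dobj = set0;
  Dagt_obj_cover : Dagt `|` Dobj = setT;
  W_neq0 : [set: W] !=set0
}.

Arguments Dagt : clear implicits.
Arguments Dobj : clear implicits.
Arguments R : clear implicits.

Definition dom (F : frame) (t : ty) : set (D F) :=
  match t with
  | agt => Dagt F
  | obj => Dobj F
  | agtobj => setT
  end.

Arguments dom : clear implicits.

(* D_{tau_1} x ... x D_{tau_n} *)
Fixpoint dprod (F : frame) (taus : seq ty) (ds : seq (D F)) : Prop :=
  match taus, ds with
  | [::], [::] => True
  | tau :: taus, d :: ds => dom F tau d /\ dprod taus ds
  | _, _ => False
  end.

(* X is a subset of D^n for some n; tuples are sequences, so that the empty
   set is one and the same relation for all n. *)
Definition nary (T : Type) (X : set (seq T)) : Prop :=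
  exists n, X `<=` [set ds | size ds = n].

(* [Jcon], [Jfun] are total functions, constrained only where the
   interpretation is meant to be defined: for X satisfying [nary] and, for
   [Jfun], arguments in the domain of the symbol. The other values are never
   consulted in evaluating well-formed formulas. *)
Record ns_model (S : signature) := NSModel {
  fr :> frame;
  Jcon : CON S -> W fr -> set (seq (D fr)) -> D fr;
  Jfun : FUN S -> W fr -> set (seq (D fr)) -> seq (D fr) -> D fr;
  Jrel : REL S -> W fr -> set (seq (D fr));
  Jcon_dom : forall c w X, nary X -> dom fr (ctype c) (Jcon c w X);
  Jfun_dom : forall f w X ds, nary X ->
    dprod (fargs f) ds -> dom fr (fres f) (Jfun f w X ds);
  Jrel_eqs : forall w, Jrel eqs w = [set ds | exists d, ds = [:: d; d]];
  Jrel_dom : forall P w, P <> eqs -> Jrel P w `<=` @dprod fr (rtype P)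
}.

Section Semantics.
Variables (S : signature) (N : ns_model S).

Definition valuation (v : VAR S -> D N) : Prop :=
  forall x, dom N (vtype x) (v x).

Definition variant (v : VAR S -> D N) (x : VAR S) (d : D N) : VAR S -> D N :=
  fun y => if y == x then d else v y.

Fixpoint ext (v : VAR S -> D N) (w : W N) (X : set (seq (D N))) (t : tm S) :
    D N :=
  match t with
  | Var x => v x
  | Con c => Jcon c w X
  | Fun f ts => Jfun f w X (map (ext v w X) ts)
  end.

Fixpoint sat (w : W N) (v : VAR S -> D N) (phi : form S) : Prop :=
  match phi with
  | Atom P ts => Jrel P w (map (ext v w (Jrel P w)) ts)
  | Neg phi => ~ sat w v phi
  | And phi psi => sat w v phi /\ sat w v psi
  | Know t phi => forall w', R N (ext v w set0 t) w w' -> sat w' v phi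
  | All x phi => forall d, dom N (vtype x) d -> sat w (variant v x d) phi
  end.

End Semantics.

Definition ns_valid (S : signature) (phi : form S) : Prop :=
  forall (N : ns_model S) (w : W N) (v : VAR S -> D N),
    valuation v -> sat w v phi.

(* Main.v *)
From Stdlib Require List.
From mathcomp Require Import all_boot.
From mathcomp Require Import boolp classical_sets.
Require Import Defs.

(** Soundness is by induction on the derivation. The axioms of HK only
    substitute variables for variables; the extension of a variable depends
    neither on the world nor on the relation X relative to which terms are
    evaluated, so the substitution lemma holds for every formula, through
    atoms and epistemic operators alike. *)

Set Implicit Arguments.
Unset Strict Implicit.
Unset Printing Implicit Defensive.

(** Arguments of a function symbol are nested in a list, so the induction hypothesis has to be
    carried to each of them by [List.Forall]. *)
Lemma tm_nested_ind (S : signature) (Q : tm S -> Prop) :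
  (forall x, Q (Var x)) -> (forall c, Q (Con c)) ->
  (forall f ts, List.Forall Q ts -> Q (Fun f ts)) -> forall t, Q t.
Proof.
move=> QV QC QF; fix IH 1; case=> [x|c|f ts]; [exact: QV | exact: QC |].
by apply: QF; elim: ts => [|t ts IHts]; constructor.
Qed.

Section Soundness.
Variables (S : signature) (N : ns_model S).
Implicit Types (x y z : VAR S) (t : tm S) (phi psi : form S).
Implicit Types (v : VAR S -> D N) (w : W N) (X : set (seq (D N))).

Lemma eq_in_ext v v' w X t :
  {in tvars t, v =1 v'} -> ext v w X t = ext v' w X t.
Proof.
elim/tm_nested_ind: t => [x|//|f ts IH] /= vv'.
  by apply: vv'; rewrite inE.
congr Jfun; elim: IH vv' => //= t {}ts IHt _ IHts vv'.
by congr cons; [apply: IHt | apply: IHts] => z zt; apply: vv';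
  rewrite mem_cat zt ?orbT.
Qed.

Lemma eq_in_map_ext v v' w X ts :
  {in flatten (map (@tvars S) ts), v =1 v'} ->
  map (ext v w X) ts = map (ext v' w X) ts.
Proof.
elim: ts => //= t ts IH vv'; congr cons; [apply: eq_in_ext | apply: IH];
  by move=> z zt; apply: vv'; rewrite mem_cat zt ?orbT.
Qed.

Lemma eq_in_sat phi v v' w :
  {in fvars phi, v =1 v'} -> sat w v phi <-> sat w v' phi.
Proof.
elim: phi v v' w => [P ts|phi IH|phi IHphi psi IHpsi|t phi IH|x phi IH] v v' w
  /= vv'.
- by rewrite (eq_in_map_ext _ _ vv').
- by rewrite (IH v v').
- by rewrite (IHphi v v') 1?(IHpsi v v') // => z zphi; apply: vv';
    rewrite mem_cat zphi ?orbT.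
- rewrite (@eq_in_ext v v'); last by move=> z zt; apply: vv'; rewrite mem_cat zt.
  have IH' w' : sat w' v phi <-> sat w' v' phi.
    by apply: IH => z zphi; apply: vv'; rewrite mem_cat zphi orbT.
  by split=> H w' /H /IH'.
- have IH' d : sat w (variant v x d) phi <-> sat w (variant v' x d) phi.
    apply: IH => z zphi; rewrite /variant; case: eqP => // /eqP zx.
    by apply: vv'; rewrite mem_filter zx.
  by split=> H d /H /IH'.
Qed.

Lemma ext_tsubst_var v w X x y t :
  ext v w X (tsubst (Var y) x t) = ext (variant v x (v y)) w X t.
Proof.
elim/tm_nested_ind: t => [z|//|f ts IH] /=.
  by rewrite /variant; case: eqP.
by congr Jfun; elim: IH => //= t {}ts -> _ ->.
Qed.

Lemma variantK v x d e : variant (variant v x d) x e = variant v x e.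
Proof. by apply/funext => z; rewrite /variant; case: eqP. Qed.

Lemma variantC v x y d e : x != y ->
  variant (variant v x d) y e = variant (variant v y e) x d.
Proof.
move=> xy; apply/funext => z; rewrite /variant.
by case: (eqVneq z y) => // ->; rewrite eq_sym (negbTE xy).
Qed.

(** The side condition prevents capture: no quantifier met on the way down rebinds [y], so its value
    stays [v y]. *)
Lemma sat_subst_var v w x y phi : y \notin bvars phi ->
  sat w v (subst (Var y) x phi) <-> sat w (variant v x (v y)) phi.
Proof.
elim: phi v w => [P ts|phi IH|phi IHphi psi IHpsi|t phi IH|z phi IH] v w /=.
- move=> _; suff -> : map (ext v w (Jrel P w)) (map (tsubst (Var y) x) ts) =
      map (ext (variant v x (v y)) w (Jrel P w)) ts by [].
  by rewrite -map_comp; apply: eq_map => t; exact: ext_tsubst_var.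
- by move=> /IH ->.
- by rewrite mem_cat negb_or => /andP[/IHphi -> /IHpsi ->].
- move=> /IH {}IH; rewrite ext_tsubst_var.
  by split=> H w' /H /IH.
- rewrite inE negb_or => /andP[yz /IH {}IH].
  (* If the bound variable is [x], substitution stops there and the inner variant overrides the
     outer one; otherwise the two variants commute. *)
  case: eqVneq => [->|zx] /=.
    by split=> H d /H; rewrite variantK.
  have IH' d : sat w (variant v z d) (subst (Var y) x phi) <->
               sat w (variant (variant v x (v y)) z d) phi.
    have -> : v y = variant v z d y by rewrite /variant (negbTE yz).
    by rewrite IH variantC.
  by split=> H d /H /IH'.
Qed.

Lemma sat_Imp v w phi psi :
  sat w v (Imp phi psi) <-> (sat w v phi -> sat w v psi).
Proof.
split=> /= [H Hphi|H [Hphi Hpsi]]; last exact: Hpsi (H Hphi).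
by apply: contrapT => Hpsi; apply: H.
Qed.

Lemma sat_Eq v w t1 t2 :
  sat w v (Eq t1 t2) <->
  ext v w (Jrel eqs w) t1 = ext v w (Jrel eqs w) t2.
Proof.
rewrite /=; move: (ext _ _ _ t1) (ext _ _ _ t2) => a b; rewrite Jrel_eqs.
by split=> [[d [-> ->]] | ->] //; exists b.
Qed.

(** At fixed [w] and [v], the truth values of satisfaction form a propositional assignment, and
    [peval] under it computes satisfaction. *)
Lemma sat_tautology v w phi : tautology phi -> sat w v phi.
Proof.
move=> /(_ (fun psi => `[< sat w v psi >])).
suff -> : peval (fun psi => `[< sat w v psi >]) phi = `[< sat w v phi >].
  by move/asboolP.
elim: phi => //= [phi ->|phi -> psi ->]; first by rewrite asbool_neg.
by rewrite asbool_and.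
Qed.

Lemma valuation_variant v x d :
  valuation v -> dom N (vtype x) d -> valuation (variant v x d).
Proof. by move=> Hv xd y; rewrite /variant; case: eqP => [->|]. Qed.

(** Agents and objects are disjoint; [base_ty] excludes [agtobj], whose domain meets both. *)
Lemma dom_base_inj a b (d : D N) : base_ty a -> base_ty b ->
  dom N a d -> dom N b d -> a = b.
Proof.
have disj : Dagt N d -> Dobj N d -> False.
  move=> da dob; suff : (Dagt N `&` Dobj N)%classic d by rewrite Dagt_obj_disj.
  by split.
by case=> -> [] -> //= d1 d2; case: disj.
Qed.

(** This makes the extension of equality an admissible parameter for [Jcon_dom]. *)
Lemma nary_Jrel_eqs w : nary (@Jrel S N eqs w).
Proof. by exists 2 => ds; rewrite Jrel_eqs => -[d ->]. Qed.

End Soundness.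

Theorem mainTheorem2 (S : signature) (phi : form S) :
  wf phi -> HK phi -> ns_valid phi.
Proof.
move=> _; elim=> {phi}.
- by move=> phi _ taut N w v _; exact: sat_tautology.
- move=> x y phi _ [/= txy bound] N w v Hv; rewrite sat_Imp => H.
  rewrite sat_subst_var; first by apply: H; rewrite txy; exact: Hv.
  by apply: bound; rewrite inE.
- by move=> t _ N w v _; rewrite sat_Eq.
- move=> x y z phi _ [_ boundx] [_ boundy] N w v _.
  rewrite !sat_Imp sat_Eq /= => vxy.
  (* As [v x = v y], both instances reduce to [phi] under the same variant at [z]. *)
  rewrite !sat_subst_var ?vxy //; first by apply: boundy; rewrite inE.
  by apply: boundx; rewrite inE.
- move=> c x txc N w v _; rewrite sat_Imp => _ H.
  (* The witness is the value of [c] relative to the extension of equality, the very relation used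
     to evaluate the atom under the quantifier. *)
  apply: (H (Jcon c w (Jrel eqs w))).
    by rewrite txc; apply: Jcon_dom; exact: nary_Jrel_eqs.
  by apply/sat_Eq; rewrite /= /variant eqxx.
- move=> x y txy N w v Hv /sat_Eq /= vxy.
  apply: txy; apply: (@dom_base_inj _ N _ _ (v x)); try exact: vtype_base.
    exact: Hv.
  by rewrite vxy; exact: Hv.
- move=> t phi psi _ _ _ _ N w v _; rewrite !sat_Imp => H1 H2 w' Rw'.
  by have /sat_Imp := H1 _ Rw'; apply; exact: H2.
- move=> x t phi _ _ _ xt N w v _; rewrite sat_Imp => H w' Rw' d xd.
  (* Since [x] does not occur in [t], changing its value leaves the agent denoted by [t], hence the
     accessible worlds, unchanged. *)
  apply: (H d xd); rewrite (@eq_in_ext _ _ _ v) // => z zt.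
  by rewrite /variant; case: eqP => // zx; rewrite zx (negbTE xt) in zt.
- move=> x y t _ _ N w v _; rewrite sat_Imp => H w' _ /sat_Eq vxy.
  (* Variables are rigid: an equality between them at [w'] holds at [w] too. *)
  by apply: H; apply/sat_Eq.
- move=> phi psi _ IH1 _ IH2 N w v Hv.
  by have /sat_Imp := IH2 N w v Hv; apply; exact: IH1.
- by move=> t phi _ _ _ IH N w v Hv w' _; exact: IH.
- move=> x phi psi xphi _ IH N w v Hv; rewrite sat_Imp => Hphi d xd.
  (* The premise is valid, so it may be used at the [x]-variant, where [phi] keeps its truth value
     because [x] is not free in it. *)
  have /sat_Imp := IH N w _ (valuation_variant Hv xd); apply.
  rewrite (@eq_in_sat _ _ _ _ v) // => z zphi.
  by rewrite /variant; case: eqP => // zx; rewrite -zx zphi in xphi.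
Qed.
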